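(* Consider an irreducible Markov chain on $V$ and an associated transfinite rotor walk started at a vertex $a$ (with any initial rotor configuration). For $n\ge1$ let $$I_n:=\max\{m\ge0: n_{m\omega}(a)<n\}.$$ Then $$\limsup_{n\to\infty}\frac{I_n}{n}\leq \mathbb{P}_a(T_a^+=\infty).$$
   Context: Markov chain: $V$ is a countable set and $p:V\times V\to[0,1]$ are the transition probabilities of a Markov chain $X_0,X_1,\ldots$ on $V$; all $p(u,v)$ are rational, and for each $u$ there are only finitely many $v$ with $p(u,v)>0$. $\mathbb{P}_u$ is the law of the chain started at $X_0=u$. $T_v^+:=\min\{t\ge 1: X_t=v\}$, with $\min\emptyset:=\infty$. Rotor mechanism: to each vertex $u$ are associated a positive integer $d(u)$ and a finite sequence of (not necessarily distinct) vertices $u^{(1)},\ldots,u^{(d(u))}$ (the successors of $u$) such that $p(u,v)=\#\{i:u^{(i)}=v\}/d(u)$ for all $u,v\in V$. Rotor walk: a rotor configuration is a map $r$ assigning to each $v\in V$ an integer $r(v)\in\{1,\ldots,d(v)\}$. Given an initial vertex $x_0$ and an initial rotor configuration $r_0$, the rotor walk is defined inductively: $r_{t+1}(v)=r_t(v)$ for $v\ne x_t$; $r_{t+1}(x_t)=r_t(x_t)+1$ if $r_t(x_t)<d(x_t)$ and $r_{t+1}(x_t)=1$ if $r_t(x_t)=d(x_t)$; and $x_{t+1}:=(x_t)^{(r_{t+1}(x_t))}$. A rotor walk is recurrent if it visits every vertex infinitely often, transient if it visits every vertex only finitely often; for an irreducible chain every rotor walk is one or the other. Transfinite rotor walk started at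 $a$: fix an initial rotor configuration $r_0$ and set $x_0=a$. If the rotor walk $x_0,x_1,\ldots$ is transient, set $r_\omega(v):=\lim_{t\to\infty}r_t(v)$, $x_\omega:=a$, and run the rotor walk $x_\omega,x_{\omega+1},\ldots$ from $(x_\omega,r_\omega)$ by the usual rules; if this is again transient set $r_{2\omega}:=\lim_{t\to\infty} r_{\omega+t}$, $x_{2\omega}:=a$, and so on. Continue up to the first $m$ for which the walk $x_{m\omega},x_{m\omega+1},\ldots$ is recurrent (after which no further restart is made), or indefinitely if it is transient for all $m$. Transfinite times are $\omega^2$ and $m\omega+t$ with $m,t$ non-negative integers, ordered lexicographically by $(m,t)$, with $m\omega+t<\omega^2$. For a transfinite time $\tau$, $n_\tau(v):=\#\{\alpha<\tau: x_\alpha=v\}$ (over times $\alpha$ at which the walk is defined; this number may be infinite). Informally, $I_n$ counts escapes to infinity of the transfinite walk, measured against the number of visits to $a$. *)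

(* Defs.v *)
From HB Require Import structures.
From mathcomp Require Import all_boot all_order all_algebra.
From mathcomp Require Import all_classical all_reals all_analysis.
Set Implicit Arguments.
Unset Strict Implicit.
Unset Printing Implicit Defensive.
Import Order.TTheory GRing.Theory Num.Theory.
Import numFieldNormedType.Exports.
Local Open Scope classical_set_scope.
Local Open Scope ring_scope.

Section MarkovChain.
Context {R : realType} {V : countType}.
Implicit Types (p : V -> V -> R) (u v : V).

Record transition_probabilities p : Prop := TransitionProbabilities {
  trans_itv : forall u v, 0 <= p u v <= 1 ;
  trans_rat : forall u v, exists q : rat, p u v = ratr q ;
  trans_finite : forall u, finite_set [set v | 0 < p u v] ;
  (* a finitely supported sum, by trans_finite *)
  trans_sum1 : forall u, \sum_(v \in [set: V]) p u v = 1 }.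

Fixpoint nstep p (t : nat) u v : R :=
  if t is t'.+1 then \sum_(w \in [set: V]) p u w * nstep p t' w v
  else (u == v)%:R.

Definition irreducible_chain p : Prop :=
  forall u v, exists t, 0 < nstep p t u v.

(* The process X has law P_u under Pr: its finite-dimensional distributions
   are those of the chain with transition probabilities p started at u. *)
Record markov_chain_from d (T : measurableType d) (Pr : probability T R)
    (X : nat -> T -> V) p u : Prop := MarkovChainFrom {
  chain_measurable : forall t v, measurable (X t @^-1` [set v]) ;
  chain_law : forall (t : nat) (x : nat -> V),
    Pr [set w | forall i : nat, (i <= t)%N -> X i w = x i] =
    ((x 0 == u)%:R * \prod_(i < t) p (x i) (x i.+1))%:E }.

(* T_v^+; the infimum of the empty set is +oo. *)
Definition return_time (T : Type) (X : nat -> T -> V) v (w : T) : \bar R :=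
  ereal_inf [set t%:R%:E | t in [set t : nat | (1 <= t)%N /\ X t w = v]].

(* The successor list of u is u^(1), ..., u^(d(u)), with d(u) its size. *)
Definition rotor_mechanism p (succs : V -> seq V) : Prop :=
  forall u, (0 < size (succs u))%N /\
    forall v, p u v = (count_mem v (succs u))%:R / (size (succs u))%:R.

End MarkovChain.

Arguments return_time R {V T}.

Section RotorWalk.
Context {V : countType}.
Variable succs : V -> seq V.
Implicit Types (a v x : V) (r : V -> nat).

Definition rotor_configuration r : Prop :=
  forall v, (1 <= r v <= size (succs v))%N.

Definition advance_rotor x r : V -> nat := fun v =>
  if v == x then (if (r x < size (succs x))%N then (r x).+1 else 1%N)
  else r v.

(* Rotors are numbered from 1 and sequences from 0: u^(i) is item i.-1. *)
Definition rotor_step (s : V * (V -> nat)) : V * (V -> nat) :=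
  let r' := advance_rotor s.1 s.2 in
  (nth s.1 (succs s.1) (r' s.1).-1, r').

Definition rotor_walk x r (t : nat) : V * (V -> nat) :=
  iter t rotor_step (x, r).

Definition transient_walk x r : Prop :=
  forall v, finite_set [set t | (rotor_walk x r t).1 = v].

(* The configuration r_{m omega}. The limit is that of the discrete space nat;
   it is meaningful only when the first m walks are all transient. *)
Fixpoint restart_configuration a r (m : nat) : V -> nat :=
  if m is m'.+1 then
    fun v => limn (fun t =>
      (rotor_walk a (restart_configuration a r m') t).2 v)
  else r.

(* The times m omega + t < omega^2 are encoded as pairs (m, t). *)
Definition time_lt (alpha tau : nat * nat) : Prop :=
  (alpha.1 < tau.1)%N \/ (alpha.1 = tau.1 /\ (alpha.2 < tau.2)%N).

Definition transfinite_position a r (alpha : nat * nat) : V :=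
  (rotor_walk a (restart_configuration a r alpha.1) alpha.2).1.

(* The walk reaches time alpha iff all its earlier stages are transient; for an
   irreducible chain the first stage that is not transient is recurrent. *)
Definition walk_defined_at a r (alpha : nat * nat) : Prop :=
  forall k, (k < alpha.1)%N ->
    transient_walk a (restart_configuration a r k).

(* n_tau(v), equal to +oo if v is visited infinitely often before tau. *)
Definition visits_before (R : realType) a r (tau : nat * nat) v : \bar R :=
  counting [set alpha : nat * nat | [/\ time_lt alpha tau,
    walk_defined_at a r alpha & transfinite_position a r alpha = v]].

(* I_n, as the element of the set that is an upper bound of it. For an
   irreducible chain and n >= 1 it exists, since n_0(a) = 0 and n_{m omega}(a)
   is at least m; the default value 0 is then not used. *)
Definition escapes (R : realType) a r (n : nat) : nat :=
  let A := [set m : nat | (visits_before R a r (m, 0%N) a < n%:R%:E)%E] in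
  xget 0%N (A `&` ubound A).

End RotorWalk.

(* Main.v *)
Require Import Defs.
From HB Require Import structures.
From mathcomp Require Import all_boot all_order all_algebra.
From mathcomp Require Import all_classical all_reals all_analysis.
From mathcomp Require Import lra.
Set Implicit Arguments.
Unset Strict Implicit.
Unset Printing Implicit Defensive.
Import Order.TTheory GRing.Theory Num.Theory.
Import numFieldNormedType.Exports.
Local Open Scope classical_set_scope.
Local Open Scope ring_scope.

(* Let h(v) be the probability that the chain from v hits a within k steps before
   leaving a finite set F, so that h(a) = 1, h = 0 off F and h is subharmonic off
   a, and let q be the mean of h over the successors of a. Give the rotor at
   v in F the weight sum_(j <= r(v)) (c(v) - h(v^(j))), where c(a) = q and
   c(v) = h(v) otherwise. Then h(position) + total rotor weight is bounded, drops
   by at most 1 - q when the walk leaves a, does not decrease at other steps, and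
   gains 1 at each restart, since h vanishes far out. Hence I_n <= n (1 - q) + C,
   and 1 - q decreases to P_a(T_a^+ = oo) when F is the out-ball of radius k + 1
   around a and k tends to infinity. *)

(** * Rotor weights and the potential *)

Section Potential.
Context {R : realType} {V : countType}.
Variable succs : V -> seq V.
Hypothesis succs_gt0 : forall v, (0 < size (succs v))%N.
Implicit Types (h c : V -> R) (r : V -> nat) (F : seq V).

Definition succ_mean h v : R :=
  (\sum_(w <- succs v) h w) / (size (succs v))%:R.

Lemma succ_mean_ge0 h v : (forall w, 0 <= h w) -> 0 <= succ_mean h v.
Proof. by move=> h0; rewrite mulr_ge0 ?invr_ge0 ?ler0n// sumr_ge0. Qed.

Lemma succ_mean_le h h' v :
  (forall w, h w <= h' w) -> succ_mean h v <= succ_mean h' v.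
Proof. by move=> hh'; rewrite ler_wpM2r ?invr_ge0 ?ler0n// ler_sum. Qed.

Lemma succ_mean_sub1 h v : succ_mean (fun w => 1 - h w) v = 1 - succ_mean h v.
Proof.
rewrite /succ_mean sumrB mulrBl big_const_seq count_predT iter_addr_0 divff//.
by rewrite pnatr_eq0 -lt0n.
Qed.

Lemma eq_succ_mean h h' v :
  {in succs v, h =1 h'} -> succ_mean h v = succ_mean h' v.
Proof. by move=> hh'; congr (_ / _); apply: eq_big_seq. Qed.

Lemma succ_mean_le1 h v : (forall w, h w <= 1) -> succ_mean h v <= 1.
Proof.
by move=> h1; rewrite -subr_ge0 -succ_mean_sub1 succ_mean_ge0// => w; rewrite subr_ge0.
Qed.

Definition rotor_weight c h v (i : nat) : R :=
  \sum_(w <- take i (succs v)) (c v - h w).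

Definition config_weight c h F r : R := \sum_(v <- F) rotor_weight c h v (r v).

Definition potential c h F (s : V * (V -> nat)) : R :=
  h s.1 + config_weight c h F s.2.

(* The full turn of the rotor at v has weight d(v) (c v - succ_mean h v) <= 0,
   so dropping it when the rotor wraps around can only raise the weight. *)
Lemma rotor_weight_step c h v (i : nat) : c v <= succ_mean h v ->
  let j := if (i < size (succs v))%N then i.+1 else 1%N in
  rotor_weight c h v i + c v <= rotor_weight c h v j + h (nth v (succs v) j.-1).
Proof.
move=> cv /=; rewrite /rotor_weight; case: ltnP => [ilt|sle] /=.
  by rewrite (take_nth v ilt) -cats1 big_cat big_seq1 -addrA subrK.
have full_le0 : \sum_(w <- succs v) (c v - h w) <= 0.
  rewrite sumrB big_const_seq count_predT iter_addr_0 subr_le0 -mulr_natr.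
  by rewrite -ler_pdivlMr// ltr0n.
rewrite take_oversize//; move: full_le0 (succs_gt0 v).
case: (succs v) => [//|w s] /= le0 _; rewrite take0 big_seq1 subrK.
by rewrite -[leRHS]add0r lerD2r.
Qed.

(** Only the rotor at [s.1] turns. Inside [F] the previous lemma applies to it; outside [F] the
    weight is unchanged and [h s.1 = 0], so the potential cannot fall. *)
Lemma potential_step c h F s : uniq F ->
  (forall w, 0 <= h w) -> {in F, forall v, c v <= succ_mean h v} ->
  (forall v, v \notin F -> h v = 0) ->
  potential c h F s + (if s.1 \in F then c s.1 - h s.1 else 0)
    <= potential c h F (rotor_step succs s).
Proof.
move=> uF h0 cF hF; case: s => x r; rewrite /potential /rotor_step /=.
case: ifPn => [xF|xNF]; last first.
  rewrite hF// add0r addr0 -[leLHS]add0r lerD//.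
  rewrite /config_weight big_seq [leRHS]big_seq ler_sum// => v vF.
  by rewrite /advance_rotor; case: eqP vF => // ->; rewrite (negbTE xNF).
rewrite /config_weight (bigD1_seq x)//= [in leRHS](bigD1_seq x)//=.
rewrite [X in _ <= _ + (_ + X)](eq_bigr (fun v => rotor_weight c h v (r v))); last first.
  by move=> v /negbTE vx; rewrite /advance_rotor vx.
have /= := rotor_weight_step (r x) (cF x xF).
have -> : advance_rotor succs x r x =
    if (r x < size (succs x))%N then (r x).+1 else 1%N.
  by rewrite /advance_rotor eqxx.
by lra.
Qed.

(** The bound is uniform in [i], since [take] keeps at most d(v) terms; it thus covers all restarted
    configurations at once. *)
Lemma rotor_weight_norm c h v (i : nat) :
  `|c v| <= 1 -> (forall w, `|h w| <= 1) ->
  `|rotor_weight c h v i| <= 2 * (size (succs v))%:R.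
Proof.
move=> c1 h1; apply: (le_trans (ler_norm_sum _ _ _)).
apply: (@le_trans _ _ (\sum_(w <- take i (succs v)) 2)).
  apply: ler_sum => w _; apply: (le_trans (ler_normB _ _)).
  by have := h1 w; lra.
rewrite big_const_seq count_predT iter_addr_0 -[leLHS]mulr_natr ler_wpM2l ?ler0n//.
by rewrite ler_nat size_take_min geq_minr.
Qed.

Lemma config_weight_norm c h F r :
  (forall v, `|c v| <= 1) -> (forall w, `|h w| <= 1) ->
  `|config_weight c h F r| <= \sum_(v <- F) 2 * (size (succs v))%:R.
Proof.
move=> c1 h1; apply: (le_trans (ler_norm_sum _ _ _)).
by apply: ler_sum => v _; exact: rotor_weight_norm.
Qed.

End Potential.

(** * Truncated hitting probabilities on finite balls *)

Section Barrier.
Context {R : realType} {V : countType}.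
Variables (succs : V -> seq V) (a : V).
Hypothesis succs_gt0 : forall v, (0 < size (succs v))%N.
Implicit Types (F : seq V).

(* P_v(X_1, ..., X_k <> a) *)
Fixpoint avoid_prob (k : nat) (v : V) : R :=
  if k is k'.+1 then succ_mean succs (fun w => (w != a)%:R * avoid_prob k' w) v
  else 1.

(* P_v(a is hit within k steps, before leaving F); the start counts. *)
Fixpoint hit_prob F (k : nat) (v : V) : R :=
  if k is k'.+1 then
    if v == a then 1 else if v \in F then succ_mean succs (hit_prob F k') v else 0
  else (v == a)%:R.

Lemma hit_prob_at F k : hit_prob F k a = 1.
Proof. by case: k => [|k] /=; rewrite eqxx. Qed.

Lemma hit_prob_out F k v : a \in F -> v \notin F -> hit_prob F k v = 0.
Proof.
move=> aF vF; have va : (v == a) = false by apply: contraNF vF => /eqP ->.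
by case: k => [|k] /=; rewrite va ?(negbTE vF).
Qed.

Lemma hit_prob_ge0 F k v : 0 <= hit_prob F k v.
Proof.
elim: k v => [|k IH] v /=; first exact: ler0n.
by case: ifP => // _; case: ifP => // _; exact: succ_mean_ge0.
Qed.

Lemma hit_prob_le1 F k v : hit_prob F k v <= 1.
Proof.
elim: k v => [|k IH] v /=; first by case: eqP.
by case: ifP => // _; case: ifP => // _; exact: succ_mean_le1.
Qed.

Lemma hit_prob_leS F k v : hit_prob F k v <= hit_prob F k.+1 v.
Proof.
elim: k v => [|k IH] v.
  by rewrite /=; case: eqP => // _; case: ifP => // _; apply: succ_mean_ge0.
rewrite [leLHS]/= [leRHS]/=.
by case: ifP => // _; case: ifP => // _; exact: succ_mean_le.
Qed.

(** At such v the right side is by definition the hitting probability with one more step allowed,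
    which is no smaller. *)
Lemma hit_prob_subharmonic F k v : v \in F -> v != a ->
  hit_prob F k v <= succ_mean succs (hit_prob F k) v.
Proof.
by move=> vF va; apply: (le_trans (hit_prob_leS _ _ _)); rewrite /= (negbTE va) vF.
Qed.

Fixpoint out_ball (k : nat) : seq V :=
  if k is k'.+1 then out_ball k' ++ flatten (map succs (out_ball k')) else [:: a].

Lemma out_ball_homo : {homo out_ball : i j / (i <= j)%N >-> {subset i <= j}}.
Proof.
move=> i j /subnKC <-; elim: (j - i)%N => [|k IH] v vi; first by rewrite addn0.
by rewrite addnS /= mem_cat IH.
Qed.

(** In j steps from radius i the chain stays within radius i + j, so the cut-off at radius k is not
    felt. The factor [(v != a)%:R] accounts for time 0, which [hit_prob] counts and [avoid_prob]
    does not. *)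
Lemma hit_prob_ball k i j v : v \in out_ball i -> (i + j <= k)%N ->
  hit_prob (undup (out_ball k)) j v = 1 - (v != a)%:R * avoid_prob j v.
Proof.
elim: j i v => [|j IH] i v vi ijk.
  by rewrite /= mulr1; case: eqP => /= _; rewrite ?subr0 ?subrr.
rewrite /= mem_undup (out_ball_homo _ vi) ?(leq_trans (leq_addr _ _) ijk)//.
case: eqP => /= _; first by rewrite mul0r subr0.
rewrite mul1r -succ_mean_sub1//; apply: eq_succ_mean => w wv.
apply: (IH i.+1); last by rewrite addSnnS.
by rewrite /= mem_cat; apply/orP; right; apply/flatten_mapP; exists v.
Qed.

(* Cutting the hitting probability off outside a finite ball makes the potential
   a finite sum; the ball is large enough not to change succ_mean at a. *)
Lemma barrier (k : nat) : exists (F : seq V) (h : V -> R),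
  [/\ [/\ uniq F, a \in F, h a = 1 & forall v, 0 <= h v <= 1],
      forall v, v \notin F -> h v = 0,
      forall v, v \in F -> v != a -> h v <= succ_mean succs h v &
      1 - succ_mean succs h a = avoid_prob k.+1 a].
Proof.
pose F := undup (out_ball k.+1).
have aF : a \in F.
  by rewrite mem_undup (out_ball_homo (leq0n _)) ?mem_seq1.
exists F, (hit_prob F k); split; first split => //.
- exact: undup_uniq.
- exact: hit_prob_at.
- by move=> v; rewrite hit_prob_ge0 hit_prob_le1.
- by move=> v vF; exact: hit_prob_out.
- by move=> v vF va; exact: hit_prob_subharmonic.
rewrite -succ_mean_sub1//; apply: eq_succ_mean => w wa.
rewrite (hit_prob_ball (i := 1))//; first by rewrite subKr.
by rewrite /= cats0 in_cons wa orbT.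
Qed.

End Barrier.

(** * Counting the restarts of the transfinite walk *)

Section Escapes.
Context {R : realType} {V : countType}.
Variables (succs : V -> seq V) (a : V).
Hypothesis succs_gt0 : forall v, (0 < size (succs v))%N.
Variables (F : seq V) (h : V -> R).
Hypotheses (uF : uniq F) (aF : a \in F) (ha : h a = 1)
  (h01 : forall v, 0 <= h v <= 1) (hF : forall v, v \notin F -> h v = 0)
  (hsub : forall v, v \in F -> v != a -> h v <= succ_mean succs h v).
Implicit Types (x v : V) (r : V -> nat).

(** Lowering the value at a from 1 to q makes [c] at most the successor mean of [h] on all of [F],
    as [potential_step] requires. *)
Let c v : R := if v == a then succ_mean succs h a else h v.
Let q := succ_mean succs h a.
Let Phi := potential succs c h F.
Let Psi := config_weight succs c h F.

Definition visit_times x r (t : nat) : seq nat :=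
  [seq i <- iota 0 t | (rotor_walk succs x r i).1 == a].

Lemma potential_walk x r t :
  Phi (x, r) <= Phi (rotor_walk succs x r t) + (size (visit_times x r t))%:R * (1 - q).
Proof.
elim: t => [|t IH]; first by rewrite /visit_times /= mul0r addr0.
rewrite /visit_times -addn1 iotaD filter_cat size_cat natrD mulrDl.
rewrite -/(visit_times x r t) add0n addn1.
apply: (le_trans IH); rewrite addrCA [leLHS]addrC lerD2l [rotor_walk _ _ _ t.+1]iterS.
rewrite -/(rotor_walk succs x r t); set s := rotor_walk _ _ _ t.
have c_le : {in F, forall v, c v <= succ_mean succs h v}.
  by move=> v vF; rewrite /c; case: eqVneq => [->|/hsub]; last exact.
have h0 w : 0 <= h w by case/andP: (h01 w).
have := potential_step succs_gt0 s uF h0 c_le hF; rewrite -/Phi /c /=.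
case: (eqVneq s.1 a) => [->|sa] /=; first by rewrite aF ha -/q; lra.
by rewrite mul0r; case: ifP => _; lra.
Qed.

Lemma rotor_walk_frozen x r v (t0 t : nat) :
  (forall i, (t0 <= i)%N -> (rotor_walk succs x r i).1 != v) -> (t0 <= t)%N ->
  (rotor_walk succs x r t).2 v = (rotor_walk succs x r t0).2 v.
Proof.
move=> novisit /subnKC <-; elim: (t - t0)%N => [|k IH]; first by rewrite addn0.
rewrite addnS [rotor_walk _ _ _ _.+1]iterS -/(rotor_walk succs x r (t0 + k)) /=.
by rewrite /advance_rotor eq_sym (negbTE (novisit _ (leq_addr _ _))) IH.
Qed.

Lemma transient_leaves x r : transient_walk succs x r ->
  exists t0, forall t v, (t0 <= t)%N -> v \in F -> (rotor_walk succs x r t).1 != v.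
Proof.
move=> tr.
have /finite_seqP[s sE] :
    finite_set (\bigcup_(v in [set` F]) [set t | (rotor_walk succs x r t).1 = v]).
  by apply: bigcup_finite => // v _; exact: tr.
exists (\max_(i <- s) i).+1 => t v tgt vF; apply/eqP => tv.
have : [set` s] t by rewrite -sE; exists v.
by move=> /= ts; move: tgt; rewrite ltnNge (@leq_bigmax_seq _ s xpredT (fun i => i) t)//.
Qed.

(** The stage starts at a, where [h] is 1. After the last visit to [F] the position has [h] equal to
    0 and the rotors in [F] have reached their limits, so [potential_walk] up to such a time
    compares the two configuration weights alone. *)
Lemma config_weight_restart r : transient_walk succs a r ->
  exists t, Psi r + 1 <=
    Psi (fun v => limn (fun t => (rotor_walk succs a r t).2 v))
      + (size (visit_times a r t))%:R * (1 - q).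
Proof.
move=> /transient_leaves[t0 leave]; exists t0.
have limE v : v \in F ->
    limn (fun t => (rotor_walk succs a r t).2 v) = (rotor_walk succs a r t0).2 v.
  move=> vF; apply: lim_near_cst; first exact: order_hausdorff.
  near=> t; apply: rotor_walk_frozen; last by near: t; exact: nbhs_infty_ge.
  by move=> i t0i; exact: leave.
have -> : Psi (fun v => limn (fun t => (rotor_walk succs a r t).2 v)) =
    Psi (rotor_walk succs a r t0).2.
  by apply: eq_big_seq => v vF; rewrite limE.
have := potential_walk a r t0; rewrite /Phi /potential -/Psi /= ha (@hF _.1).
  by rewrite add0r [Psi r + 1]addrC.
by apply/negP => /(leave t0 _ (leqnn _)); rewrite eqxx.
Unshelve. all: by end_near. Qed.

(** The stages telescope. The visits to a are kept as a list of distinct transfinite times, to be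
    compared with [counting] later. *)
Lemma config_weight_stages r m :
  (forall k, (k < m)%N -> transient_walk succs a (restart_configuration succs a r k)) ->
  exists S : seq (nat * nat), [/\ uniq S,
    forall alpha, alpha \in S ->
      (alpha.1 < m)%N /\ transfinite_position succs a r alpha = a &
    Psi r + m%:R <=
      Psi (restart_configuration succs a r m) + (size S)%:R * (1 - q)].
Proof.
elim: m => [|m IH] tr; first by exists [::]; rewrite /= mul0r.
have [k km|S [uS inS leS]] := IH; first by apply: tr; rewrite ltnS ltnW.
have [t let_] := config_weight_restart (tr m (ltnSn m)).
exists (map (pair m) (visit_times a (restart_configuration succs a r m) t) ++ S).
split.
- rewrite cat_uniq uS andbT map_inj_uniq; last by move=> i j [].
  rewrite filter_uniq ?iota_uniq//=; apply/hasPn => -[k i] /inS[/= km _].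
  by apply/mapP => -[j _ [kE]]; rewrite kE ltnn in km.
- move=> [k i]; rewrite mem_cat => /orP[/mapP[j]|/inS[/= km ->]]; last first.
    by split=> //; rewrite ltnS ltnW.
  by rewrite mem_filter => /andP[/eqP ja _] [-> ->].
- rewrite size_cat size_map natrD mulrDl -natr1 /=.
  by move: leS let_; lra.
Qed.

Lemma size_le_counting (T : choiceType) (A : set T) (S : seq T) :
  uniq S -> [set` S] `<=` A -> ((size S)%:R%:E <= counting A :> \bar R)%E.
Proof.
move=> uS SA; rewrite /counting; case: asboolP => [finA|_]; last exact: leey.
rewrite lee_fin ler_nat; apply: uniq_leq_size => // x xS.
by rewrite in_fset_set// inE; exact: SA.
Qed.

(* If some stage before m fails to be transient then no time is defined after
   it, so m.+1 would be in the set of which m is an upper bound. *)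
Lemma escapes_spec r (n : nat) : let m := escapes succs R a r n in
  m = 0%N \/
  (visits_before succs R a r (m, 0%N) a < n%:R%:E)%E /\
  forall k, (k < m)%N -> transient_walk succs a (restart_configuration succs a r k).
Proof.
rewrite /escapes; set A := [set m | _].
case: xgetP => [m _ [Am ubm]|_]; [right; split=> // k km|by left].
apply: contrapT => ntr; suff /ubm : A m.+1 by rewrite leEnat ltnn.
rewrite /A /= /visits_before [X in counting X](_ : _ = [set alpha : nat * nat |
  [/\ time_lt alpha (m, 0%N), walk_defined_at succs a r alpha
    & transfinite_position succs a r alpha = a]])//.
apply/seteqP; split => alpha /= [lt_al def_al pos_al]; split => //.
- left => /=; case: (leqP m alpha.1) => // /(leq_trans km)/def_al.
  by move/ntr.
- by case: lt_al => [/= /ltnW|[]//]; left.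
Qed.

(** The factor 2 in front of the sum arises because [Psi] is bounded both at the start and after m
    stages. *)
Lemma escapes_le r (n : nat) :
  (escapes succs R a r n)%:R <=
    n%:R * (1 - q) + 2 * \sum_(v <- F) 2 * (size (succs v))%:R :> R.
Proof.
have h1 w : `|h w| <= 1 by case/andP: (h01 w) => ? ?; rewrite ger0_norm.
have q01 : 0 <= q <= 1.
  rewrite succ_mean_ge0 ?succ_mean_le1// => w; by case/andP: (h01 w).
have c1 w : `|c w| <= 1.
  rewrite /c; case: eqP => // _; case/andP: q01 => q0 q1.
  by rewrite ger0_norm.
have Psi_le r' : `|Psi r'| <= \sum_(v <- F) 2 * (size (succs v))%:R.
  exact: config_weight_norm.
set C := \sum_(v <- F) _ in Psi_le *.
have C0 : 0 <= C by rewrite sumr_ge0// => v _; rewrite mulr_ge0.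
case/andP: q01 => q0 q1.
(* The case 0 includes the default value of [xget]; there the bound is merely nonnegative. *)
have [->|[vis tr]] := escapes_spec r n.
  by rewrite addr_ge0 ?mulr_ge0 ?subr_ge0.
set m := escapes _ _ _ _ _ in vis tr *.
have [S [uS inS leS]] := config_weight_stages tr.
(* Every time in [S] counts towards n_{m omega}(a), which is below n by the choice of m. *)
have Sn : (size S)%:R <= n%:R :> R.
  rewrite -lee_fin; apply: le_trans (ltW vis); apply: size_le_counting => //.
  move=> alpha /= /inS[lt_al pos]; split => //; first by left.
  by move=> k /ltn_trans/(_ lt_al)/tr.
have {}leS : m%:R <= Psi (restart_configuration succs a r m) - Psi r +
    n%:R * (1 - q).
  have : (size S)%:R * (1 - q) <= n%:R * (1 - q) by rewrite ler_wpM2r ?subr_ge0.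
  by move: leS; lra.
have := Psi_le r; have := Psi_le (restart_configuration succs a r m).
by rewrite !ler_norml => /andP[_ ?] /andP[? _]; move: leS; lra.
Qed.

End Escapes.

(** * Non-return probabilities of the chain *)

Section Avoidance.
Context {R : realType} {V : countType}.
Variables (p : V -> V -> R) (succs : V -> seq V) (a : V).
Hypothesis hsuccs : rotor_mechanism p succs.
Context {disp : measure_display} {T : measurableType disp}.
Variables (Pa : probability T R) (X : nat -> T -> V).
Hypothesis hX : markov_chain_from Pa X p a.

(** Grouping repeated successors turns the rotor average into a one-step expectation under [p]; in a
    duplicate-free list, different next states give disjoint events. *)
Lemma succ_mean_undup (f : V -> R) v :
  succ_mean succs f v = \sum_(w <- undup (succs v)) p v w * f w.
Proof.
rewrite /succ_mean -big_undup_iterop_count mulr_suml; apply: eq_bigr => w _.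
rewrite (hsuccs v).2 mulrAC; congr (_ / _).
by rewrite mulr_natl.
Qed.

Definition avoid_event (t k : nat) : set T :=
  [set w | forall i, (t < i <= t + k)%N -> X i w <> a].

Definition cylinder (t : nat) (x : nat -> V) : set T :=
  [set w | forall i, (i <= t)%N -> X i w = x i].

Lemma measurable_avoid_event t k : measurable (avoid_event t k).
Proof.
rewrite [avoid_event _ _](_ : _ =
  \bigcap_(i in [set i | (t < i <= t + k)%N]) ~` (X i @^-1` [set a])).
  apply: bigcap_measurableType => i _; apply: measurableC.
  exact: (chain_measurable hX).
by apply/seteqP; split => w.
Qed.

Lemma measurable_cylinder t x : measurable (cylinder t x).
Proof.
rewrite [cylinder _ _](_ : _ =
  \bigcap_(i in [set i | (i <= t)%N]) (X i @^-1` [set x i])).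
  by apply: bigcap_measurableType => i _; exact: (chain_measurable hX).
by apply/seteqP; split => w.
Qed.

(** Induction on k, splitting a cylinder by the state at time t + 1, stands in for the Markov
    property. An inequality suffices for an upper bound on the limsup, so only successors other than
    a are considered. *)
Lemma avoid_prob_le_cylinder k t (x : nat -> V) :
  (((x 0%N == a)%:R * \prod_(i < t) p (x i) (x i.+1) * avoid_prob succs a k (x t))%:E
    <= Pa (cylinder t x `&` avoid_event t k))%E.
Proof.
elim: k t x => [|k IH] t x.
  rewrite mulr1 -(chain_law hX) -/(cylinder t x).
  rewrite [avoid_event _ _](_ : _ = setT) ?setIT//.
  by apply/seteqP; split => // w _ i; rewrite addn0 => /andP[/leq_trans/[apply]]; rewrite ltnn.
pose D := [seq w <- undup (succs (x t)) | w != a].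
have uD : uniq D by rewrite filter_uniq ?undup_uniq.
(* The path x up to time t, continued by v; only its values up to t + 1 are read. *)
pose y v i := if (i <= t)%N then x i else v.
have y_le v i : (i <= t)%N -> y v i = x i by rewrite /y => ->.
have y_S v : y v t.+1 = v by rewrite /y ltnn.
pose E v := cylinder t.+1 (y v) `&` avoid_event t.+1 k.
have mE v : measurable (E v).
  by apply: measurableI; [exact: measurable_cylinder|exact: measurable_avoid_event].
apply: (@le_trans _ _ (Pa (\bigcup_(v in [set` D]) E v))); last first.
  apply: le_measure; rewrite ?inE; [exact: fin_bigcup_measurable| |].
    by apply: measurableI; [exact: measurable_cylinder|exact: measurable_avoid_event].
  move=> w [v /= vD [cw aw]]; split => i.
    by move=> it; rewrite cw ?y_le// ltnW.
  case/andP; rewrite leq_eqVlt => /orP[/eqP <- _|ti it].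
    by rewrite cw// y_S; move: vD; rewrite mem_filter => /andP[/eqP].
  by apply: aw; rewrite ti addSnnS.
have -> : Pa (\bigcup_(v in [set` D]) E v) = (\sum_(v <- D) Pa (E v))%E.
  rewrite measure_fin_bigcup//; [by rewrite (fsbig_seq _ _ uD)|exact: finite_seq|].
  move=> u v _ _ [w [[cu _] [cv _]]].
  by rewrite -(y_S u) -(y_S v) -cu// -cv.
rewrite big_filter /= succ_mean_undup mulr_sumr.
rewrite -sumEFin big_mkcond [leRHS]big_mkcond /=; apply: lee_sum => v _.
case: ifPn => va; last by rewrite mul0r !mulr0.
apply: le_trans (IH t.+1 (y v)); rewrite lee_fin y_le// y_S big_ord_recr /=.
rewrite y_le// y_S mul1r !mulrA.
rewrite [in leRHS](eq_bigr (fun i : 'I_t => p (x i) (x i.+1)))// => i _.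
by rewrite !y_le// ltnW.
Qed.

Lemma avoid_prob_le k : ((avoid_prob succs a k a)%:E <= Pa (avoid_event 0 k))%E.
Proof.
have := avoid_prob_le_cylinder k 0 (fun=> a); rewrite eqxx big_ord0 !mul1r.
move=> /le_trans; apply; apply: le_measure; rewrite ?inE.
- by apply: measurableI; [exact: measurable_cylinder|exact: measurable_avoid_event].
- exact: measurable_avoid_event.
- by move=> w [].
Qed.

Lemma no_return_avoid :
  [set w | return_time R X a w = +oo%E] = \bigcap_k avoid_event 0 k.
Proof.
apply/seteqP; split => w /=.
  move=> /ereal_inf_pinfty noret k _ i /andP[i0 _] Xi.
  by have /noret : [set t%:R%:E | t in [set t : nat | (1 <= t)%N /\ X t w = a]] (i%:R%:E : \bar R)
    by exists i.
move=> avoid; apply/ereal_inf_pinfty => _ [i [i0 Xi] <-].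
by case: (avoid i Logic.I i) => //; rewrite i0 leqnn.
Qed.

Lemma cvg_avoid_event :
  (Pa (avoid_event 0 k) @[k --> \oo] --> Pa [set w | return_time R X a w = +oo%E])%E.
Proof.
rewrite no_return_avoid; apply: nonincreasing_cvg_mu.
- by rewrite (le_lt_trans (probability_le1 _ _)) ?ltry//; exact: measurable_avoid_event.
- by move=> k; exact: measurable_avoid_event.
- by apply: bigcap_measurableType => k _; exact: measurable_avoid_event.
- move=> k l kl; apply/subsetPset => w aw i /andP[i0 ik]; apply: aw.
  by rewrite i0 (leq_trans ik).
Qed.

End Avoidance.

(** * Passage to the limit *)

Lemma limn_esup_ratio_le (R : realType) (u : nat -> nat) (b C : R) :
  (forall n, (u n)%:R <= n%:R * b + C) ->
  (limn_esup (fun n : nat => ((u n)%:R / n%:R)%:E) <= b%:E)%E.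
Proof.
move=> ub; apply/lee_addgt0Pr => e e0.
(* From N on, C / n is at most e; the successor also keeps n positive. *)
pose N := (Num.bound (`|C| / e)).+1.
apply: (@le_trans _ _ (ereal_sup [set ((u n)%:R / n%:R)%:E | n in [set n | (N <= n)%N]])).
  apply: ereal_inf_lbound; exists [set n | (N <= n)%N] => //.
  exact: nbhs_infty_ge.
apply: ge_ereal_sup => _ [n /= Nn <-].
have n0 : 0 < n%:R :> R by rewrite ltr0n (leq_trans _ Nn).
rewrite -EFinD lee_fin ler_pdivrMr//; apply: (le_trans (ub n)).
rewrite mulrDl mulrC lerD2l (le_trans (ler_norm _))// -ler_pdivrMl// mulrC.
have Ce : `|C| / e < (Num.bound (`|C| / e))%:R.
  by rewrite archi_boundP// divr_ge0// ltW.
by rewrite (le_trans (ltW Ce))// ler_nat ltnW.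
Qed.

Theorem theorem10 (R : realType) (V : countType) (p : V -> V -> R)
    (succs : V -> seq V) (a : V) (r0 : V -> nat)
    (disp : measure_display) (T : measurableType disp)
    (Pa : probability T R) (X : nat -> T -> V)
    (hp : transition_probabilities p)
    (hirr : irreducible_chain p)
    (hsuccs : rotor_mechanism p succs)
    (hr0 : rotor_configuration succs r0)
    (hX : markov_chain_from Pa X p a) :
  (limn_esup (fun n : nat => ((escapes succs R a r0 n)%:R / n%:R)%:E)
     <= Pa [set w | return_time R X a w = +oo])%E.
Proof.
have succs_gt0 v : (0 < size (succs v))%N := (hsuccs v).1.
(* The additive constant depends on k through [F], but k is fixed while n tends to infinity. *)
have esc_le k : (limn_esup (fun n : nat => ((escapes succs R a r0 n)%:R / n%:R)%:E)
     <= Pa (avoid_event a X 0 k.+1))%E.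
  apply: le_trans (avoid_prob_le hsuccs hX _).
  have [F [h [[uF aF ha h01] hF hsub <-]]] := barrier (R := R) a succs_gt0 k.
  apply: limn_esup_ratio_le => n.
  exact: (escapes_le succs_gt0 uF aF ha h01 hF hsub).
rewrite -(cvg_lim _ (cvg_avoid_event hX))//; apply: lime_ge.
  by apply/cvg_ex; eexists; exact: cvg_avoid_event hX.
near=> k; have /prednK <- : (0 < k)%N by near: k; exact: nbhs_infty_gt.
exact: esc_le.
Unshelve. all: by end_near. Qed.
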